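(* Fix $\beta\in(0,1)$. Then the function $\gamma\mapsto N(\beta,\gamma)$ on $\mathbb{R}$ is locally piecewise constant, with only finitely many jumps on compact intervals; that is, every compact interval of $\mathbb{R}$ can be partitioned into finitely many subintervals (possibly single points) on each of which $N(\beta,\cdot)$ is constant.
   Context: Setting (finite discounted risk-sensitive MDP). $E=\{x_1,\dots,x_k\}$ is a finite state space and $U=\{\tilde u_1,\dots,\tilde u_l\}$ a finite action space (both nonempty); every action is available in every state. For $a\in U$, $P^a=[p_a(x_i,x_j)]_{i,j=1}^k$ is a transition probability matrix. $c\colon E\times U\to\mathbb{R}$ is a fixed running reward. $(X_n)_{n\ge 0}$ is the canonical state process. A policy is a sequence $\pi=(a_n)_{n\ge0}$, where $a_n$ is a $U$-valued function of $(X_0,\dots,X_n)$; $\Pi$ is the set of all policies. $\mathbb{E}_x^\pi$ is the expectation under the law of the process with $X_0=x$ and $\mathbb{P}(X_{n+1}=y\mid X_0,\dots,X_n)=p_{a_n}(X_n,y)$. $\Pi''\subset\Pi$ is the set of Markov policies, identified with sequences $(u_n)_{n\ge0}$, $u_n\colon E\to U$, via $a_n=u_n(X_n)$. $\Pi'\subset\Pi''$ is the set of stationary Markov policies, identified with functions $u\colon E\to U$, via $a_n=u(X_n)$ for all $n$. For $\gamma\in\mathbb{R}$, $\beta\in(0,1)$, $x\in E$, $\pi=(a_i)_{i\ge 0}\in\Pi$, put $$J_\gamma(x,\pi;\beta):=\begin{cases}\frac1\gamma\ln\mathbb{E}_x^\pi\big[e^{\gamma\sum_{i=0}^\infty\beta^i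 c(X_i,a_i)}\big],&\gamma\ne0,\\ \mathbb{E}_x^\pi\big[\sum_{i=0}^\infty\beta^i c(X_i,a_i)\big],&\gamma=0.\end{cases}$$ $\Pi^*(\beta,\gamma)$ is the set of Markov policies $\pi\in\Pi''$ that are optimal for every starting point, i.e. $J_\gamma(x,\pi;\beta)=\sup_{\pi'\in\Pi}J_\gamma(x,\pi';\beta)$ for all $x\in E$. Turnpike: a Markov policy is ultimately stationary if it is of the form $(u_0,\dots,u_{N-1},u,u,\dots)$ for some $N\in\mathbb{N}=\{1,2,\dots\}$ and functions $u_0,\dots,u_{N-1},u\colon E\to U$. For $\beta\in(0,1)$ and $\gamma\in\mathbb{R}$ (for which an optimal ultimately stationary policy always exists), $N(\beta,\gamma)\in\mathbb{N}$ is the earliest ultimate stationarity threshold, i.e. the smallest $N\in\mathbb{N}$ such that there is a policy of the form $(u_0,\dots,u_{N-1},u,u,\dots)$ in $\Pi^*(\beta,\gamma)$. *)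

(* Defs.v *)
From HB Require Import structures.
From mathcomp Require Import all_boot all_order all_algebra.
From mathcomp Require Import all_classical all_reals all_analysis.

Set Implicit Arguments.
Unset Strict Implicit.
Unset Printing Implicit Defensive.

Import Order.TTheory GRing.Theory Num.Theory.
Import numFieldNormedType.Exports.

Local Open Scope classical_set_scope.
Local Open Scope ring_scope.

(* The k.+1 states are 'I_k.+1 and the l.+1 actions are 'I_l.+1, so that both
   sets are finite and nonempty. *)
Record mdp (R : realType) (k l : nat) := Mdp {
  trans : 'I_l.+1 -> 'M[R]_k.+1;
  trans_ge0 : forall a x y, 0 <= trans a x y;
  trans_sum1 : forall a x, \sum_y trans a x y = 1;
  reward : 'I_k.+1 -> 'I_l.+1 -> R }.

Definition policy (k l : nat) := forall n, n.+1.-tuple 'I_k.+1 -> 'I_l.+1.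

Definition markov (k l : nat) (u : nat -> 'I_k.+1 -> 'I_l.+1) : policy k l :=
  fun n h => u n (tnth h ord_max).

(* Measurable types are required to be pointed. *)
HB.instance Definition _ (k : nat) := isPointed.Build 'I_k.+1 ord0.

Definition coordinate_sets (k : nat) : set_system (nat -> 'I_k.+1) :=
  [set [set w | w ny.1 = ny.2] | ny in [set: nat * 'I_k.+1]].

(* Path space with the product sigma-algebra; the canonical process is
   evaluation, X_n(w) = w n. *)
Notation path_space k := (g_sigma_algebraType (@coordinate_sets k)).

Definition hist (k : nat) (w : nat -> 'I_k.+1) (n : nat) : n.+1.-tuple 'I_k.+1 :=
  [tuple w i | i < n.+1].

Definition action_at (k l : nat) (pi : policy k l) (w : nat -> 'I_k.+1)
  (n : nat) : 'I_l.+1 := pi n (hist w n).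

(* The process starts at x and
     P(X_{n+1} = y | (X_0, .., X_n) = h) = p_{pi_n(h)}(h_n, y),
   written in product form to avoid conditioning on null histories. *)
Definition is_path_law (R : realType) (k l : nat) (M : mdp R k l)
    (x : 'I_k.+1) (pi : policy k l) (P : probability (path_space k) R) :=
  P [set w | w 0%N = x] = 1%E /\
  forall n (h : n.+1.-tuple 'I_k.+1) (y : 'I_k.+1),
    P [set w | hist w n = h /\ w n.+1 = y] =
    (P [set w | hist w n = h] * (trans M (pi n h) (tnth h ord_max) y)%:E)%E.

Fixpoint revpath (k : nat) (w : nat -> 'I_k.+1) (n : nat) : seq 'I_k.+1 :=
  if n is m.+1 then w m :: revpath w m else [::].

Lemma revpathE k (w : nat -> 'I_k.+1) n : revpath w n = rev (mkseq w n).
Proof. by elim: n => //= n ->; rewrite mkseqS rev_rcons. Qed.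

Section UnitLaw.
Context {R : realType}.

Definition unit_law : set (measurableTypeR R) -> \bar R :=
  mrestr lebesgue_measure (measurable_itv `[0 : R, 1[).

HB.instance Definition _ := Measure.on unit_law.

Let unit_lawT : unit_law setT = 1%E.
Proof.
by rewrite /unit_law /mrestr setTI lebesgue_measure_itv /= lte_fin ltr01 sube0.
Qed.

HB.instance Definition _ := Measure_isProbability.Build _ _ _ unit_law unit_lawT.

End UnitLaw.

(* Existence of the law: the process is realized on [0, 1[ with Lebesgue
   measure, by splitting intervals along histories. *)
Section Existence.
Context (R : realType) (k : nat) (q : seq 'I_k.+1 -> 'I_k.+1 -> R).
Context (q_ge0 : forall s y, 0 <= q s y)
  (q_sum1 : forall s, \sum_y q s y = 1).

(* Histories are listed most recent state first. *)
Fixpoint cell_len (s : seq 'I_k.+1) : R :=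
  if s is y :: s' then cell_len s' * q s' y else 1.

Fixpoint cell_lo (s : seq 'I_k.+1) : R :=
  if s is y :: s' then cell_lo s' + cell_len s' * \sum_(z : 'I_k.+1 | (z < y)%N) q s' z
  else 0.

Definition cell s : interval R := `[cell_lo s, cell_lo s + cell_len s[.

Definition nxt (t : R) s : 'I_k.+1 :=
  odflt ord0 [pick y | t \in cell (y :: s)].

Fixpoint revhist (t : R) (n : nat) : seq 'I_k.+1 :=
  if n is m.+1 then nxt t (revhist t m) :: revhist t m else [::].

Lemma cell_len_ge0 s : 0 <= cell_len s.
Proof. by elim: s => //= y s ih; rewrite mulr_ge0. Qed.

Let F s (j : nat) : R := cell_lo s + cell_len s * \sum_(z : 'I_k.+1 | (z < j)%N) q s z.

Let F_homo s : {homo F s : i j / (i <= j)%N >-> i <= j}.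
Proof.
move=> i j ij; rewrite lerD2l ler_wpM2l ?cell_len_ge0//.
rewrite [leRHS](bigID (fun z : 'I_k.+1 => (z < i)%N)) /=.
rewrite [X in _ <= X + _](eq_bigl (fun z : 'I_k.+1 => (z < i)%N)); last first.
  by move=> z; case: (ltnP z i) => zi; rewrite ?andbF ?andbT ?(leq_trans zi ij).
by rewrite lerDl sumr_ge0.
Qed.

Let F0 s : F s 0%N = cell_lo s.
Proof. by rewrite /F big_pred0 ?mulr0 ?addr0. Qed.

Let FT s : F s k.+1 = cell_lo s + cell_len s.
Proof.
rewrite /F (eq_bigl xpredT) ?q_sum1 ?mulr1// => z; exact: ltn_ord.
Qed.

Let cellE s (y : 'I_k.+1) t : (t \in cell (y :: s)) = (F s y <= t < F s y.+1).
Proof.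
rewrite in_itv /=; congr (_ && (_ < _)).
rewrite /F -addrA -mulrDr [in RHS](bigD1 y) //=.
congr (_ + _ * _); rewrite addrC; congr (_ + _); apply: eq_bigl => z.
by rewrite ltnS ltn_neqAle andbC.
Qed.

Let cell_sub s y t : t \in cell (y :: s) -> t \in cell s.
Proof.
rewrite cellE => /andP[yt ty]; rewrite in_itv /= -FT -F0.
rewrite (le_trans _ yt) ?F_homo//= (lt_le_trans ty)// F_homo//; exact: ltn_ord.
Qed.

Let cell_inj s y z t : t \in cell (y :: s) -> t \in cell (z :: s) -> y = z.
Proof.
rewrite !cellE => /andP[y1 y2] /andP[z1 z2]; apply/val_inj/eqP => /=.
rewrite eqn_leq; apply/andP; split; rewrite leqNgt; apply/negP => /(F_homo s) h.
- by have := lt_le_trans z2 (le_trans h y1); rewrite ltxx.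
- by have := lt_le_trans y2 (le_trans h z1); rewrite ltxx.
Qed.

Let nxtP s t : t \in cell s -> t \in cell (nxt t s :: s).
Proof.
rewrite in_itv /= -FT -F0 => /andP[t0 tT].
rewrite /nxt; case: pickP => //= none; exfalso.
have H j : (j <= k.+1)%N -> F s j <= t.
  elim: j => // j ih jk; have := none (Ordinal jk); rewrite cellE /= ih ?(ltnW jk)//=.
  by move/negbT; rewrite -leNgt.
by have := lt_le_trans tT (H _ (leqnn _)); rewrite ltxx.
Qed.

Let cell_nil t : (t \in cell [::]) = (0 <= t < 1).
Proof. by rewrite in_itv /= add0r. Qed.

Let revhistP t s : t \in cell [::] -> (revhist t (size s) = s) <-> (t \in cell s).
Proof.
move=> t01; elim: s => [|y s [ih1 ih2]] //=; split.
  by case=> ey es; rewrite -ey es; apply: nxtP; exact: ih1.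
move=> ty; have ts := cell_sub ty; rewrite ih2//; congr (_ :: _).
exact: (cell_inj (nxtP ts) ty).
Qed.

Definition sample (t : measurableTypeR R) : path_space k :=
  let t' := if 0 <= t < 1 then t else 0 in fun n => nxt t' (revhist t' n).

Lemma size_revhist t n : size (revhist t n) = n.
Proof. by elim: n => //= n ->. Qed.

Let revpath_sample t n :
  revpath (sample t) n = revhist (if 0 <= t < 1 then t else 0) n.
Proof. by elim: n => //= n ->. Qed.

Lemma measurable_revhist s :
  measurable [set t : R | revhist (if 0 <= t < 1 then t else 0) (size s) = s].
Proof.
pose B := [set _ : R | revhist 0 (size s) = s].
rewrite (_ : mkset _ = [set` cell s] `&` `[0, 1[ `|` ~` `[0, 1[ `&` B).
  have mI01 : measurable (`[0, 1[ : set R) by exact: measurable_itv.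
  apply: measurableU; apply: measurableI; [exact: measurable_itv|by []| |].
    exact: measurableC.
  have [e|e] := pselect (revhist 0 (size s) = s).
    rewrite (_ : B = setT); first exact: measurableT.
    by apply/seteqP; split.
  rewrite (_ : B = set0); first exact: measurable0.
  by apply/seteqP; split.
have I01 (t : R) : (t \in `[0, 1[) = (0 <= t < 1) by rewrite in_itv.
apply/seteqP; split=> t /=; rewrite I01.
  case: ifP => [t01 /revhistP h|t01 h]; last by right; split.
  by left; split=> //; apply: h; rewrite cell_nil.
case=> [[ts t01]|[/negP/negbTE -> //]].
by rewrite t01; apply/revhistP => //; rewrite cell_nil.
Qed.

Lemma measurable_sample : measurable_fun setT sample.
Proof.
apply: (@measurability _ _ _ (path_space k) _ _ (@coordinate_sets k)) => //.
move=> _ [_ [[n y] _ <-] <-]; rewrite setTI /=.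
rewrite (_ : _ @^-1` _ = \bigcup_(s in [set: n.-tuple 'I_k.+1])
  [set t : R | revhist (if 0 <= t < 1 then t else 0) (size (y :: s)) = y :: s]).
  by apply: fin_bigcup_measurable => // s _; exact: measurable_revhist.
apply/seteqP; split=> t /=.
  rewrite /sample => ty.
  set t' := if _ then _ else _ in ty *.
  by exists (Tuple (introT eqP (size_revhist t' n))) => //=; rewrite size_revhist ty.
by case=> s _; rewrite /= size_tuple => -[e _]; exact: e.
Qed.


HB.instance Definition _ :=
  isMeasurableFun.Build _ _ (measurableTypeR R) (path_space k) sample measurable_sample.

Lemma exists_law_of_cylinders : exists P : probability (path_space k) R,
  forall s, P [set w | revpath w (size s) = s] = (cell_len s)%:E.
Proof.
exists (distribution (@unit_law R) sample) => s.
rewrite /distribution /pushforward /= /unit_law /mrestr.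
rewrite (_ : _ `&` _ = [set` cell s]).
  rewrite lebesgue_measure_itv /= lte_fin ltrDl -EFinB addrC addKr.
  by rewrite lt_neqAle cell_len_ge0 andbT; case: eqP => [<-|].
apply/seteqP; split=> t /=.
  rewrite in_itv /= revpath_sample => -[+ t01]; rewrite t01 => /revhistP; apply.
  by rewrite cell_nil.
move=> ts; have t01 : 0 <= t < 1.
  by rewrite -cell_nil; elim: s ts => // y s ih /cell_sub.
rewrite in_itv /= revpath_sample t01; split=> //.
by apply/revhistP => //; rewrite cell_nil.
Qed.

End Existence.

Lemma exists_path_law (R : realType) (k l : nat) (M : mdp R k l)
    (x : 'I_k.+1) (pi : policy k l) :
  exists P : probability (path_space k) R, is_path_law M x pi P.
Proof.
pose q s y : R :=
  if s is z :: s' then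
    trans M (pi (size s') [tuple nth z (rev s) i | i < (size s').+1]) z y
  else (y == x)%:R.
have q0 s y : 0 <= q s y by case: s => [|z s]; [rewrite ler0n|exact: trans_ge0].
have q1 s : \sum_y q s y = 1.
  case: s => [|z s]; last exact: trans_sum1.
  by rewrite (bigD1 x) //= eqxx big1 ?addr0// => y /negbTE ->.
have [P HP] := exists_law_of_cylinders q0 q1; exists P; split.
  have := HP [:: x]; rewrite /= eqxx !mul1r => <-; congr (P _).
  by apply/seteqP; split=> w /= => [->|[]].
move=> n h y.
have E w : (hist w n = h) <-> (revpath w n.+1 = rev h).
  have -> : revpath w n.+1 = rev (hist w n).
    by rewrite revpathE /mkseq -val_enum_ord -map_comp.
  by split=> [->//|/(can_inj revK)/val_inj].
have -> : [set w | hist w n = h] = [set w | revpath w (size (rev h)) = rev h].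
  by rewrite size_rev size_tuple; apply/seteqP; split=> w /E.
have -> : [set w | hist w n = h /\ w n.+1 = y] =
    [set w | revpath w (size (y :: rev h)) = y :: rev h].
  rewrite /= size_rev size_tuple; apply/seteqP; split=> w.
    by move=> [/E e e'] /=; rewrite -e -e'.
  by move=> -[e0 e1]; split=> //; apply/E.
rewrite !HP /= EFinM; congr (_ * _%:E)%E.
case eh : (rev h) => [|z s'].
  by have := size_tuple h; rewrite -size_rev eh.
have es : size s' = n by have := size_tuple h; rewrite -size_rev eh => -[].
have -> : tnth h ord_max = z.
  rewrite (tnth_nth z) -[X in nth _ X]revK eh rev_cons nth_rcons size_rev es.
  by rewrite ltnn eqxx.
have G m : m = n -> pi m [tuple nth z h i | i < m.+1] = pi n h.
  move=> ->; congr (pi n _); apply: eq_from_tnth => i.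
  by rewrite tnth_mktuple (tnth_nth z).
by rewrite /q -eh revK G.
Qed.

(* The law is unique (cylinders form a pi-system), so which one is picked does
   not matter. *)
Definition path_law (R : realType) (k l : nat) (M : mdp R k l) (x : 'I_k.+1)
    (pi : policy k l) : probability (path_space k) R :=
  projT1 (cid (exists_path_law M x pi)).

Lemma path_lawP (R : realType) (k l : nat) (M : mdp R k l) (x : 'I_k.+1)
  (pi : policy k l) : is_path_law M x pi (path_law M x pi).
Proof. exact: projT2 (cid _). Qed.

Definition total_reward (R : realType) (k l : nat) (M : mdp R k l) (beta : R)
    (pi : policy k l) (w : path_space k) : R :=
  limn (series (fun i => beta ^+ i * reward M (w i) (action_at pi w i))).

(* For 0 < beta < 1 the series above converges and total_reward is bounded, so
   the expectations are finite and fine loses nothing; likewise the sup below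
   is that of a nonempty bounded set of reals. *)
Definition J (R : realType) (k l : nat) (M : mdp R k l) (beta gamma : R)
    (x : 'I_k.+1) (pi : policy k l) : R :=
  if gamma == 0 then fine ('E_(path_law M x pi)[total_reward M beta pi])
  else gamma^-1 * ln (fine ('E_(path_law M x pi)[
    (fun w => expR (gamma * total_reward M beta pi w))])).

Definition optimal_markov (R : realType) (k l : nat) (M : mdp R k l)
    (beta gamma : R) (u : nat -> 'I_k.+1 -> 'I_l.+1) : Prop :=
  forall x, J M beta gamma x (markov u) =
            sup [set J M beta gamma x pi | pi in [set: policy k l]].

Definition stationarity_threshold (R : realType) (k l : nat) (M : mdp R k l)
    (beta gamma : R) (N : nat) : Prop :=
  (0 < N)%N /\
  exists (u : nat -> 'I_k.+1 -> 'I_l.+1) (v : 'I_k.+1 -> 'I_l.+1),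
    (forall n, (N <= n)%N -> u n = v) /\ optimal_markov M beta gamma u.

(* N(beta, gamma); the default 0, which is not a threshold, would only be
   taken if no optimal ultimately stationary policy existed. *)
Definition turnpike (R : realType) (k l : nat) (M : mdp R k l)
    (beta gamma : R) : nat :=
  xget 0%N [set N | stationarity_threshold M beta gamma N /\
    forall N', stationarity_threshold M beta gamma N' -> (N <= N')%N].

(* Main.v *)
Require Import Defs.
From HB Require Import structures.
From mathcomp Require Import all_boot all_order all_algebra.
From mathcomp Require Import all_classical all_reals all_analysis.
From mathcomp Require Import measurable_realfun ring lra.

Import Order.TTheory GRing.Theory Num.Theory.
Import numFieldNormedType.Exports.

Local Open Scope classical_set_scope.
Local Open Scope ring_scope.

Set Implicit Arguments.
Unset Strict Implicit.
Unset Printing Implicit Defensive.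

(** At a risk factor g <> 0, maximising J amounts to maximising s * W(g, x, pi) for
    every starting state x, where s is the sign of g and W is the exponential utility
    E_x^pi exp(g S), S being the total discounted reward.  The factor 0 can be left
    out, as it may form a piece of the partition by itself.  Two facts about W drive
    the proof.

    Analyticity.  As S is bounded, g |-> W(g, x, pi) is entire of exponential type,
    so the difference of two such functions either vanishes identically or has
    isolated zeros.  Hence it has a constant sign on a small interval to the right
    of any point, and on one to the left ([sgr_laplace_difference]).  So the order
    in which W ranks finitely many policies is also constant there
    ([utility_order_constant]).

    Dynamic programming.  W satisfies a Bellman recursion in which each step
    multiplies the factor by beta ([exp_utility_markov]), and a solution of the
    Bellman inequalities dominates every history-dependent policy
    ([verification], a supermartingale argument).

    Combining the two, some stationary policy is optimal for all factors of a
    given sign that are close enough to 0 ([optimal_stationary_small]): the policy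
    improvement step, if it helps at one small factor, helps at all of them, so a
    stationary policy that is best among stationary ones at one small factor cannot
    be improved at any.  Near a point t, every factor g <> 0 becomes that small after
    being multiplied by beta ^ N, for one N; N steps of backward induction
    ([optimal_extension]) show that an optimal policy can be found among the
    finitely many that use a constant rule from time N on.  Which of these are
    optimal is decided by the ranking above, hence does not change on a one-sided
    neighbourhood of t; nor does the turnpike ([turnpike_locally_constant]).
    Compactness of [a, b], in the form of a supremum argument, then gives the
    finite partition ([piecewise_constant_on_itv]). *)

(** * From one-sided local constancy to finite partitions *)

Section IntervalPartitions.
Context {R : realType} {T : Type}.
Implicit Types (F : R -> T) (A : set R) (I J : interval R) (a b : R).

Definition piecewise_constant_on F A :=
  exists (n : nat) (I : nat -> interval R),
    partition `I_n (fun i => [set` I i]) A /\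
    (forall i, (i < n)%N -> forall g g' : R, g \in I i -> g' \in I i -> F g = F g').

Lemma piecewise_constant_on0 F : piecewise_constant_on F set0.
Proof.
exists 0%N, (fun=> `]0, 0[); split; last by [].
by split; [rewrite /cover bigcup0|move=> i|].
Qed.

Lemma piecewise_constant_onU F A J :
  piecewise_constant_on F A -> A `&` [set` J] = set0 ->
  (forall g g', g \in J -> g' \in J -> F g = F g') ->
  piecewise_constant_on F (A `|` [set` J]).
Proof.
have [-> pcA _ _|/eqP J0] := pselect ([set` J] = set0); first by rewrite setU0.
move=> [n [I [[cI tI nI] cst]]] AJ cstJ.
pose I' i := if (i < n)%N then I i else J.
have I'E i : (i < n)%N -> I' i = I i by rewrite /I' => ->.
have I'n : I' n = J by rewrite /I' ltnn.
have disj i x : (i < n)%N -> x \in I i -> x \in J -> False.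
  by move=> i_n xI xJ; rewrite -[False]/(set0 x) -AJ; split => //; rewrite -cI; exists i.
exists n.+1, I'; split; first split.
- rewrite /cover IIS bigcup_setU bigcup_set1 I'n; congr (_ `|` _).
  by rewrite -cI; apply: eq_bigcupr => i /= i_n; rewrite I'E.
- move=> i j /=; rewrite !ltnS leq_eqVlt [(j <= n)%N]leq_eqVlt.
  move=> /predU1P[->|i_n] /predU1P[->|j_n] //; rewrite ?I'n ?I'E // => -[x /= [x1 x2]].
  + by have [] := disj j x.
  + by have [] := disj i x.
  + by apply: (tI i j) => //; exists x.
- move=> i /=; rewrite ltnS leq_eqVlt => /predU1P[->|i_n].
    by rewrite I'n; apply/set0P.
  by rewrite I'E //; exact: nI.
- move=> i; rewrite ltnS leq_eqVlt => /predU1P[->|i_n]; first by rewrite I'n.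
  by rewrite I'E //; exact: cst.
Qed.

(** The side is given by s: right of t for s = 1, left of t for s = -1.  Nothing is
    asked at t itself, which will form a piece of its own. *)
Definition locally_constant_aside F (s t : R) :=
  exists2 e : R, 0 < e &
    forall h h', 0 < h < e -> 0 < h' < e -> F (t + s * h) = F (t + s * h').

(** Let m be the supremum of the t such that [a, t] can be partitioned.  A partition
    of some [a, t] with t close to m extends by ]t, m[ and {m}, so m is one of these
    t; and m < b is impossible, since ]m, r] could be added for some r > m. *)
Lemma piecewise_constant_on_itv F a b : a <= b ->
  (forall t, locally_constant_aside F 1 t) ->
  (forall t, locally_constant_aside F (-1) t) ->
  piecewise_constant_on F [set` `[a, b]].
Proof.
move=> ab Fr Fl.
pose S := [set t | a <= t <= b /\ piecewise_constant_on F [set` `[a, t]]].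
have Sa : S a.
  split; first by rewrite lexx.
  rewrite -[X in piecewise_constant_on _ X]set0U.
  apply: piecewise_constant_onU; [exact: piecewise_constant_on0|by rewrite set0I|].
  by move=> g g'; rewrite !in_itv /= => /le_anti -> /le_anti ->.
have ubS : ubound S b by move=> t [/andP[]].
have supS : has_sup S by split; [exists a|exists b].
have as_ : a <= sup S by apply: ub_le_sup => //; exists b.
have sb : sup S <= b by apply: ge_sup => //; exists a.
have [e e0 Fe] := Fl (sup S).
have Ss : S (sup S).
  split; first by rewrite as_ sb.
  have [t St te] := sup_adherent e0 supS.
  have ts : t <= sup S by apply: ub_le_sup => //; exists b.
  case: St => /andP[at_ tb] pct.
  have [<-//|tNs] := eqVneq t (sup S).
  have {tNs}ts' : t < sup S by rewrite lt_neqAle tNs.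
  have -> : [set` `[a, sup S]] = [set` `[a, t]] `|` [set` `]t, sup S[] `|` [set` `[sup S, sup S]].
    apply/seteqP; split=> x /=; rewrite !in_itv /=.
      move=> /andP[ax xs]; have [xt|tx] := leP x t; first by left; left; rewrite ax.
      have [xs'|sx] := ltP x (sup S); first by left; right.
      by right; rewrite xs.
    case=> [[/andP[ax xt]|/andP[tx xs]]|/andP[sx xs]].
    - by rewrite ax (le_trans xt).
    - by rewrite (ltW xs) (le_trans at_ (ltW tx)).
    - by rewrite xs (le_trans as_ sx).
  apply: piecewise_constant_onU.
  - apply: piecewise_constant_onU => //.
      apply/seteqP; split=> x //= []; rewrite !in_itv /= => /andP[_ xt] /andP[tx _].
      by have := le_lt_trans xt tx; rewrite ltxx.
    move=> g g'; rewrite !in_itv /= => /andP[tg gs] /andP[tg' gs'].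
    have := Fe (sup S - g) (sup S - g'); rewrite !mulN1r !subKr; apply.
      by rewrite subr_gt0 gs ltrBlDl -ltrBlDr (lt_trans te tg).
    by rewrite subr_gt0 gs' ltrBlDl -ltrBlDr (lt_trans te tg').
  - apply/seteqP; split=> x //= -[[|]]; rewrite !in_itv /= => /andP[x1 x2] /andP[x3 _].
      by have := lt_le_trans (le_lt_trans x2 ts') x3; rewrite ltxx.
    by have := lt_le_trans x2 x3; rewrite ltxx.
  - by move=> g g'; rewrite !in_itv /= => /le_anti -> /le_anti ->.
have [sbE|sNb] := eqVneq (sup S) b; first by rewrite -sbE; case: Ss.
have {sNb}sb' : sup S < b by rewrite lt_neqAle sNb.
have [e' e'0 Fe'] := Fr (sup S).
pose r := Num.min b (sup S + e' / 2).
have sr : sup S < r by rewrite lt_min sb' ltrDl divr_gt0.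
have re' : r < sup S + e'.
  by rewrite gt_min; apply/orP; right; rewrite ltrD2l ltr_pdivrMr // ltr_pMr // ltr1n.
suff /(ub_le_sup (ex_intro _ b ubS)) : S r by rewrite leNgt sr.
split; first by rewrite (le_trans as_ (ltW sr)) ge_min lexx.
have -> : [set` `[a, r]] = [set` `[a, sup S]] `|` [set` `]sup S, r]].
  apply/seteqP; split=> x /=; rewrite !in_itv /=.
    by move=> /andP[ax xr]; have [xs|sx] := leP x (sup S); [left; rewrite ax|right].
  case=> /andP[x1 x2]; first by rewrite x1 (le_trans x2 (ltW sr)).
  by rewrite x2 (le_trans as_ (ltW x1)).
apply: piecewise_constant_onU; first by case: Ss.
  apply/seteqP; split=> x //= []; rewrite !in_itv /= => /andP[_ xt] /andP[tx _].
  by have := le_lt_trans xt tx; rewrite ltxx.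
move=> g g'; rewrite !in_itv /= => /andP[sg gr] /andP[sg' gr'].
have := Fe' (g - sup S) (g' - sup S); rewrite !mul1r ![sup S + _]addrC !subrK; apply.
  by rewrite subr_gt0 sg ltrBlDl (le_lt_trans gr).
by rewrite subr_gt0 sg' ltrBlDl (le_lt_trans gr').
Qed.

End IntervalPartitions.

(** * Signs of functions of exponential type *)

Section ExponentialType.
Context {R : realType}.
Implicit Types (x : R) (m n : nat).

Lemma expR_ge_series x n : 0 <= x -> series (exp_coeff x) n <= expR x.
Proof.
move=> x0; apply: nondecreasing_cvgn_le; last exact: is_cvg_series_exp_coeff.
apply/nondecreasing_seqP => i; rewrite /series /= big_nat_recr //= lerDl.
exact: exp_coeff_ge0.
Qed.

Lemma expR_taylor x m :
  `|expR x - \sum_(n < m) x ^+ n / n`!%:R| <=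
  `|x| ^+ m / m`!%:R * expR `|x|.
Proof.
have partial N : (m <= N)%N ->
    `|series (exp_coeff x) N - \sum_(n < m) x ^+ n / n`!%:R| <=
    `|x| ^+ m / m`!%:R * expR `|x|.
  move=> mN; rewrite /series /= (big_cat_nat (leq0n m) mN) //= big_mkord addrAC subrr add0r.
  rewrite -{1}[m]add0n big_addn.
  apply: (le_trans (ler_norm_sum _ _ _)).
  apply: (@le_trans _ _ (`|x| ^+ m / m`!%:R * series (exp_coeff `|x|) (N - m)%N)).
    rewrite /series /= mulr_sumr; apply: ler_sum => j _.
    rewrite normrM normrX [`|_^-1|]ger0_norm ?invr_ge0 ?ler0n //.
    rewrite exprD mulrACA [_ ^+ j * _]mulrC ler_wpM2l ?mulr_ge0 ?exprn_ge0 //.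
    (* j`! * m`! <= (j + m)`!, as the quotient is a binomial coefficient. *)
    rewrite -invfM lef_pV2 ?posrE ?mulr_gt0 ?ltr0n ?fact_gt0 //.
    rewrite -natrM ler_nat; apply: dvdn_leq; first exact: fact_gt0.
    by rewrite -(@bin_fact (j + m) m) ?leq_addl // addnK dvdn_mull.
  rewrite ler_wpM2l ?divr_ge0 ?exprn_ge0 ?ler0n //.
  exact: expR_ge_series.
have cv : `|series (exp_coeff x) N - \sum_(n < m) x ^+ n / n`!%:R| @[N --> \oo]
    --> `|expR x - \sum_(n < m) x ^+ n / n`!%:R|.
  apply: cvg_norm; apply: cvgB; last exact: cvg_cst.
  exact: is_cvg_series_exp_coeff.
rewrite -(cvg_lim _ cv) //; apply: limr_le; first by apply/cvg_ex; eexists; exact: cv.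
by near=> N; apply: partial; near: N; exact: nbhs_infty_ge.
Unshelve. all: by end_near. Qed.

Lemma sgr_close (a x : R) : `|x - a| < `|a| -> Num.sg x = Num.sg a.
Proof.
case: (ltrgt0P a) => [a0|a0|->]; last by rewrite normr_lt0.
- by rewrite ltr_distl subrr => /andP[x0 _]; rewrite !gtr0_sg.
- by rewrite ltr_distl => /andP[_]; rewrite subrr => x0; rewrite !ltr0_sg.
Qed.

(** The hypothesis expands f in powers of h on the whole half-line.  If all
    coefficients vanish, letting m grow shows that f vanishes; otherwise f has the
    sign of the first nonzero coefficient near 0. *)
Lemma sgr_eventually_constant (f : R -> R) (c : nat -> R) (A K : R) :
  0 <= A -> 0 <= K ->
  (forall m (h : R), 0 <= h ->
     `|f h - \sum_(n < m) c n * h ^+ n| <= A * ((K * h) ^+ m / m`!%:R) * expR (K * h)) ->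
  exists2 e : R, 0 < e & exists s, forall h, 0 < h < e -> Num.sg (f h) = s.
Proof.
move=> A0 K0 fc; have [[m0 cm0]|c0] := pselect (exists m, c m != 0); last first.
  have cE n : c n = 0.
    by apply/eqP/negPn/negP => cn; apply: c0; exists n.
  exists 1 => //; exists 0 => h /andP[h0 _]; apply/eqP; rewrite sgr_eq0 -normr_le0.
  have cv : A * ((K * h) ^+ m / m`!%:R) * expR (K * h) @[m --> \oo] --> (0 : R).
    have e0 : A * 0 * expR (K * h) = 0 by rewrite mulr0 mul0r.
    rewrite -[X in _ --> X]e0.
    apply: cvgM; last exact: cvg_cst.
    by apply: cvgM; [exact: cvg_cst|exact: cvg_exp_coeff].
  rewrite -(cvg_lim _ cv) //; apply: limr_ge; first by apply/cvg_ex; eexists; exact: cv.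
  near=> m; have := fc m h (ltW h0).
  by rewrite big1 ?subr0 // => i _; rewrite cE mul0r.
have /ex_minnP[m cm mmin] : exists m, c m != 0 by exists m0.
pose B := A * (K ^+ m.+1 / m.+1`!%:R) * expR K.
have B0 : 0 <= B by rewrite !mulr_ge0 ?invr_ge0 ?exprn_ge0 ?ler0n ?expR_ge0.
exists (Num.min 1 (`|c m| / (B + 1))).
  by rewrite lt_min ltr01 divr_gt0 ?normr_gt0 // ltr_wpDl.
exists (Num.sg (c m)) => h /andP[h0]; rewrite lt_min => /andP[h1].
rewrite ltr_pdivlMr ?ltr_wpDl // => hB.
have -> : Num.sg (c m) = Num.sg (c m * h ^+ m).
  by rewrite sgrM sgrX [Num.sg h]gtr0_sg // expr1n mulr1.
(* The remainder after the leading term is at most B * h ^+ m.+1, and h is small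
   enough for this to be less than the leading term. *)
apply: sgr_close.
have := fc m.+1 h (ltW h0); rewrite big_ord_recr /= big1 ?add0r; last first.
  move=> i _; have [->|ci] := eqVneq (c i) 0; first by rewrite mul0r.
  by have := mmin _ ci; rewrite leqNgt ltn_ord.
move=> /le_lt_trans; apply.
rewrite normrM normrX (gtr0_norm h0).
apply: (@le_lt_trans _ _ (h * B * h ^+ m)).
  have -> : A * ((K * h) ^+ m.+1 / m.+1`!%:R) * expR (K * h) =
      h * (A * (K ^+ m.+1 / m.+1`!%:R) * expR (K * h)) * h ^+ m.
    by rewrite exprMn [h ^+ m.+1]exprS; ring.
  rewrite ler_wpM2r ?exprn_ge0 ?(ltW h0) // ler_wpM2l ?(ltW h0) //.
  rewrite ler_wpM2l ?mulr_ge0 ?invr_ge0 ?exprn_ge0 ?ler0n //.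
  by rewrite ler_expR ler_piMr // ltW.
rewrite ltr_pM2r ?exprn_gt0 //; apply: le_lt_trans hB.
by rewrite ler_wpM2l ?(ltW h0) // lerDl.
Unshelve. all: by end_near. Qed.

End ExponentialType.

Lemma lower_bound_gt0 (R : realType) (I : finType) (e : I -> R) : (forall i, 0 < e i) ->
  exists2 d : R, 0 < d & forall i, d <= e i.
Proof.
move=> e0; exists (\big[Num.min/1]_i e i); last by move=> i; exact: bigmin_le.
by apply: lt_bigmin.
Qed.

(** * Bounded random variables and their Laplace transforms *)

Section BoundedRandomVariables.
Context d (T : measurableType d) (R : realType) (P : probability T R).
Implicit Types (X Y : T -> R).

Definition bounded_rv X :=
  measurable_fun [set: T] X /\ exists B : R, forall w, `|X w| <= B.

Lemma eq_bounded_rv X Y : X =1 Y -> bounded_rv X -> bounded_rv Y.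
Proof. by move=> /funext ->. Qed.

Lemma bounded_rv_cst r : bounded_rv (fun=> r).
Proof. by split; [exact: measurable_cst|exists `|r|]. Qed.

Lemma bounded_rvD X Y :
  bounded_rv X -> bounded_rv Y -> bounded_rv (fun w => X w + Y w).
Proof.
move=> [mX [A XA]] [mY [B YB]]; split; first exact: measurable_funD.
by exists (A + B) => w; rewrite (le_trans (ler_normD _ _)) // lerD.
Qed.

Lemma bounded_rvM X Y :
  bounded_rv X -> bounded_rv Y -> bounded_rv (fun w => X w * Y w).
Proof.
move=> [mX [A XA]] [mY [B YB]]; split; first exact: measurable_funM.
by exists (A * B) => w; rewrite normrM ler_pM.
Qed.

Lemma bounded_rvZ r X : bounded_rv X -> bounded_rv (fun w => r * X w).
Proof. by apply: bounded_rvM; exact: bounded_rv_cst. Qed.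

Lemma bounded_rvX X n : bounded_rv X -> bounded_rv (fun w => X w ^+ n).
Proof.
move=> bX; elim: n => [|n ih]; first exact: bounded_rv_cst.
by under eq_fun do rewrite exprS; exact: bounded_rvM.
Qed.

Lemma bounded_rv_expR X : bounded_rv X -> bounded_rv (fun w => expR (X w)).
Proof.
move=> [mX [A XA]]; split; first exact: measurableT_comp.
exists (expR A) => w; rewrite ger0_norm ?expR_ge0 // ler_expR.
exact: le_trans (ler_norm _) (XA w).
Qed.

Lemma bounded_rv_sum (I : Type) (s : seq I) (F : I -> T -> R) :
  (forall i, bounded_rv (F i)) -> bounded_rv (fun w => \sum_(i <- s) F i w).
Proof.
move=> bF; elim: s => [|i s ih].
  by under eq_fun do rewrite big_nil; exact: bounded_rv_cst.
by under eq_fun do rewrite big_cons; exact: bounded_rvD.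
Qed.

Lemma bounded_rv_integrable X : bounded_rv X -> P.-integrable setT (EFin \o X).
Proof.
move=> [mX [B XB]]; apply: measurable_bounded_integrable => //.
  by apply: (le_lt_trans (probability_le1 P measurableT)); rewrite ltry.
by exists B; split=> [|r Br w _]; [exact: num_real|exact: le_trans (XB w) (ltW Br)].
Qed.

Lemma Rintegral_sum (I : Type) (s : seq I) (F : I -> T -> R) :
  (forall i, bounded_rv (F i)) ->
  \int[P]_w (\sum_(i <- s) F i w) = \sum_(i <- s) \int[P]_w F i w.
Proof.
move=> bF; elim: s => [|i s ih].
  under eq_Rintegral do rewrite big_nil.
  by rewrite Rintegral_cst // mul0r big_nil.
under eq_Rintegral do rewrite big_cons.
by rewrite RintegralD ?ih ?big_cons //; apply: bounded_rv_integrable => //;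
  exact: bounded_rv_sum.
Qed.

Lemma Rintegral_le X Y : bounded_rv X -> bounded_rv Y ->
  (forall w, X w <= Y w) -> \int[P]_w X w <= \int[P]_w Y w.
Proof. by move=> bX bY XY; apply: le_Rintegral => //; exact: bounded_rv_integrable. Qed.

Lemma Rintegral_prob_cst r : \int[P]_w (fun=> r) w = r.
Proof. by rewrite Rintegral_cst // [X in fine X](_ : _ = 1%E) ?mulr1 //; exact: probability_setT. Qed.

Lemma Rintegral_indicator (A : set T) : measurable A ->
  \int[P]_w (\1_A w) = fine (P A).
Proof. by move=> mA; rewrite /Rintegral integral_indic // setIT. Qed.

Lemma bounded_rv_indic (A : set T) : measurable A -> bounded_rv (\1_A : T -> R).
Proof.
move=> mA; split; first exact: measurable_indic.
by exists 1 => w; rewrite indicE; case: (_ \in _); rewrite ?normr1 ?normr0.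
Qed.

(** Integrating the pointwise Taylor bound of exp((t + s h) X) in h gives the expansion
    of the Laplace transform at t without exchanging a limit and an integral. *)
Lemma laplace_expansion X (K t s : R) :
  measurable_fun [set: T] X -> (forall w, `|X w| <= K) -> `|s| = 1 ->
  exists c : nat -> R, forall m (h : R), 0 <= h ->
    `|\int[P]_w expR ((t + s * h) * X w) - \sum_(n < m) c n * h ^+ n| <=
    expR (`|t| * K) * ((K * h) ^+ m / m`!%:R) * expR (K * h).
Proof.
move=> mX XK s1.
have bX : bounded_rv X by split => //; exists K.
pose Y n w := expR (t * X w) * ((s * X w) ^+ n / n`!%:R).
have bE r : bounded_rv (fun w => expR (r * X w)).
  by apply: bounded_rv_expR; exact: bounded_rvZ.
have bY n : bounded_rv (Y n).
  apply: bounded_rvM; first exact: bE.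
  apply: bounded_rvM; last exact: bounded_rv_cst.
  by apply: bounded_rvX; exact: bounded_rvZ.
exists (fun n => \int[P]_w Y n w) => m h h0.
have bYh n : bounded_rv (fun w => h ^+ n * Y n w) by exact: bounded_rvZ.
have -> : \sum_(n < m) \int[P]_w Y n w * h ^+ n =
    \int[P]_w (\sum_(n < m) h ^+ n * Y n w).
  rewrite Rintegral_sum //; apply: eq_bigr => n _.
  by rewrite RintegralZl 1?mulrC //; exact: bounded_rv_integrable.
have bS : bounded_rv (fun w => \sum_(n < m) h ^+ n * Y n w) by exact: bounded_rv_sum.
have K0 : 0 <= K by have := XK (point : T); apply: le_trans.
rewrite -RintegralB //; [|exact: bounded_rv_integrable..].
have bD : bounded_rv (fun w => expR ((t + s * h) * X w) - \sum_(n < m) h ^+ n * Y n w).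
  by under eq_fun do rewrite -mulN1r; apply: bounded_rvD => //; exact: bounded_rvZ.
apply: (le_trans (le_normr_Rintegral _ (bounded_rv_integrable bD))) => //.
rewrite -[leRHS]Rintegral_prob_cst; apply: Rintegral_le.
- by case: bD => mD [B DB]; split; [exact: measurableT_comp|exists B => w; rewrite normr_id].
- exact: bounded_rv_cst.
move=> w.
have -> : expR ((t + s * h) * X w) - \sum_(n < m) h ^+ n * Y n w =
    expR (t * X w) * (expR (s * h * X w) - \sum_(n < m) (s * h * X w) ^+ n / n`!%:R).
  rewrite mulrDl expRD mulrBr; congr (_ - _); rewrite mulr_sumr.
  by apply: eq_bigr => n _; rewrite /Y !exprMn; ring.
have le_sh : `|s * h * X w| <= K * h.
  by rewrite !normrM s1 mul1r (ger0_norm h0) mulrC ler_wpM2r.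
rewrite normrM -[leRHS]mulrA; apply: ler_pM => //.
  rewrite (ger0_norm (expR_ge0 _)) ler_expR (le_trans (ler_norm _)) //.
  by rewrite normrM ler_wpM2l.
apply: (le_trans (expR_taylor _ _)); apply: ler_pM.
- by rewrite divr_ge0 ?exprn_ge0.
- exact: expR_ge0.
- by rewrite ler_wpM2r ?invr_ge0 ?ler0n // lerXn2r ?nnegrE ?mulr_ge0.
- by rewrite ler_expR.
Qed.

End BoundedRandomVariables.

Lemma sgr_laplace_difference d (T : measurableType d) (R : realType)
    (P P' : probability T R) (X X' : T -> R) (K t s : R) :
  measurable_fun [set: T] X -> (forall w, `|X w| <= K) ->
  measurable_fun [set: T] X' -> (forall w, `|X' w| <= K) -> `|s| = 1 ->
  exists2 e : R, 0 < e & exists r, forall h, 0 < h < e ->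
    Num.sg (\int[P]_w expR ((t + s * h) * X w) -
            \int[P']_w expR ((t + s * h) * X' w)) = r.
Proof.
move=> mX XK mX' XK' s1.
have K0 : 0 <= K by have := XK (point : T); apply: le_trans.
have [c cP] := laplace_expansion P t mX XK s1.
have [c' cP'] := laplace_expansion P' t mX' XK' s1.
pose f h := \int[P]_w expR ((t + s * h) * X w) - \int[P']_w expR ((t + s * h) * X' w).
apply: (@sgr_eventually_constant _ f (fun n => c n - c' n)
  (expR (`|t| * K) + expR (`|t| * K)) K) => //.
move=> m h h0; rewrite /f.
under eq_bigr do rewrite mulrBl.
rewrite sumrB !mulrDl.
set a := \int[P]_w _; set b := \int[P']_w _; set u := \sum_(i < m) _; set v := \sum_(i < m) _.
have -> : a - b - (u - v) = (a - u) - (b - v) by lra.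
by apply: (le_trans (ler_normB _ _)); apply: lerD; [exact: cP|exact: cP'].
Qed.

(** * Integrals over path space *)

Section Paths.
Context (R : realType) (k l : nat) (M : mdp R k l).
Local Notation E := 'I_k.+1.
Local Notation U := 'I_l.+1.
Implicit Types (pi : policy k l) (w : path_space k) (x y : E) (a : U) (n : nat).

Lemma tnth_hist w n (i : 'I_n.+1) : tnth (hist w n) i = w i.
Proof. by rewrite tnth_mktuple. Qed.

Lemma measurable_coordinate n y :
  measurable ([set w | w n = y] : set (path_space k)).
Proof. by apply: sub_sigma_algebra; exists (n, y). Qed.

Lemma measurable_hist n (h : n.+1.-tuple E) :
  measurable ([set w | hist w n = h] : set (path_space k)).
Proof.
rewrite [X in measurable X](_ : _ = \bigcap_(i in [set: 'I_n.+1]) [set w : path_space k | w i = tnth h i]).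
  apply: fin_bigcap_measurable => [|i _]; last exact: measurable_coordinate.
  exact: finite_finset.
apply/seteqP; split=> w /=; first by move=> <- i _ /=; rewrite tnth_hist.
by move=> wh; apply: eq_from_tnth => i; rewrite tnth_hist wh.
Qed.

Lemma measurable_hist_next n (h : n.+1.-tuple E) y :
  measurable ([set w | hist w n = h /\ w n.+1 = y] : set (path_space k)).
Proof. exact: measurableI (measurable_hist h) (measurable_coordinate n.+1 y). Qed.

Lemma hist_sum n (f : n.+1.-tuple E -> R) w :
  f (hist w n) = \sum_h f h * \1_[set w | hist w n = h] w.
Proof.
rewrite (bigD1 (hist w n)) //= big1 ?addr0.
  by rewrite indicE mem_set ?mulr1.
move=> h /eqP hw; rewrite indicE memNset ?mulr0 //.
by move=> /= wh; apply: hw; rewrite wh.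
Qed.

Lemma hist_next_sum n (f : n.+1.-tuple E -> E -> R) w :
  f (hist w n) (w n.+1) =
  \sum_h \sum_y f h y * \1_[set w | hist w n = h /\ w n.+1 = y] w.
Proof.
rewrite (bigD1 (hist w n)) //= [X in _ + X]big1 ?addr0.
  rewrite (bigD1 (w n.+1)) //= big1 ?addr0.
    by rewrite indicE mem_set ?mulr1.
  move=> y /eqP hy; rewrite indicE memNset ?mulr0 //.
  by move=> /= -[_ wy]; apply: hy; rewrite wy.
move=> h /eqP hw; rewrite big1 // => y _; rewrite indicE memNset ?mulr0 //.
by move=> /= -[wh _]; apply: hw; rewrite wh.
Qed.

Lemma bounded_rv_hist n (f : n.+1.-tuple E -> R) :
  bounded_rv (fun w : path_space k => f (hist w n)).
Proof.
apply: (eq_bounded_rv (fun w => esym (hist_sum f w))).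
apply: bounded_rv_sum => h; apply: bounded_rvZ; apply: bounded_rv_indic.
exact: measurable_hist.
Qed.

Lemma bounded_rv_coordinate n (f : E -> R) :
  bounded_rv (fun w : path_space k => f (w n)).
Proof.
apply: eq_bounded_rv (bounded_rv_hist (fun h : n.+1.-tuple E => f (tnth h ord_max))).
by move=> w /=; rewrite tnth_hist.
Qed.

(** The transition rule of the law, summed over histories, plays the part of a
    conditional expectation given the first n.+1 states. *)
Lemma Rintegral_hist_next x pi n (f : n.+1.-tuple E -> E -> R) :
  \int[path_law M x pi]_w f (hist w n) (w n.+1) =
  \int[path_law M x pi]_w (\sum_y trans M (action_at pi w n) (w n) y * f (hist w n) y).
Proof.
have [_ law] := path_lawP M x pi.
set P := path_law M x pi in law *.
pose g h := \sum_y trans M (pi n h) (tnth h ord_max) y * f h y.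
have -> : \int[P]_w (\sum_y trans M (action_at pi w n) (w n) y * f (hist w n) y) =
    \int[P]_w g (hist w n).
  by apply: eq_Rintegral => w _; rewrite /g tnth_hist.
under eq_Rintegral do rewrite hist_next_sum.
under [RHS]eq_Rintegral do rewrite hist_sum.
have bi (A : set (path_space k)) r : measurable A -> bounded_rv (fun w => r * \1_A w).
  by move=> mA; apply: bounded_rvZ; exact: bounded_rv_indic.
have iA (A : set (path_space k)) r : measurable A ->
    \int[P]_w (r * \1_A w) = r * fine (P A).
  move=> mA; rewrite RintegralZl ?Rintegral_indicator //.
  by apply: bounded_rv_integrable; exact: bounded_rv_indic.
rewrite [LHS]Rintegral_sum; last first.
  by move=> h; apply: bounded_rv_sum => y; apply: bi; exact: measurable_hist_next.
rewrite [RHS]Rintegral_sum; last by move=> h; apply: bi; exact: measurable_hist.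
apply: eq_bigr => h _.
rewrite Rintegral_sum; last by move=> y; apply: bi; exact: measurable_hist_next.
rewrite iA; last exact: measurable_hist.
rewrite /g mulr_suml; apply: eq_bigr => y _.
rewrite iA; last exact: measurable_hist_next.
rewrite law fineM //; last first.
  by apply: fin_num_measure; exact: measurable_hist.
by rewrite /=; ring.
Qed.

Lemma Rintegral_start x pi (f : E -> R) :
  \int[path_law M x pi]_w f (w 0%N) = f x.
Proof.
have [start _] := path_lawP M x pi.
set P := path_law M x pi in start *.
have mx := measurable_coordinate 0 x.
pose D : set (path_space k) := [set w | w 0%N = x].
have bD : bounded_rv (\1_D : path_space k -> R) by exact: bounded_rv_indic.
have bnD : bounded_rv (\1_(~` D) : path_space k -> R).
  by apply: bounded_rv_indic; exact: measurableC.
have bf := bounded_rv_coordinate 0 (fun y => f y - f x).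
have zero : \int[P]_w (\1_(~` D) w) = 0.
  rewrite Rintegral_indicator; last exact: measurableC.
  by rewrite probability_setC // start subee.
apply/eqP; rewrite -subr_eq0 -normr_le0.
rewrite -[X in _ - X](Rintegral_prob_cst P) -RintegralB //; last 2 first.
- by apply: bounded_rv_integrable; exact: bounded_rv_coordinate.
- by apply: bounded_rv_integrable; exact: bounded_rv_cst.
apply: (le_trans (le_normr_Rintegral _ _)) => //; first exact: bounded_rv_integrable.
have [mf [B fB]] := bf.
rewrite -[leRHS](mulr0 B) -zero -RintegralZl //; last exact: bounded_rv_integrable.
apply: Rintegral_le.
- by split; [exact: measurableT_comp|exists B => w; rewrite normr_id].
- exact: bounded_rvZ.
move=> w; rewrite indicE in_setC; case: (pselect (D w)) => Dw.
  by rewrite (mem_set Dw) /= mulr0 Dw subrr normr0.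
by rewrite memNset //= mulr1.
Qed.

End Paths.

(** * The total discounted reward *)

Section Rewards.
Context (R : realType) (k l : nat) (M : mdp R k l) (beta : R).
Context (hbeta : 0 < beta < 1).
Local Notation E := 'I_k.+1.
Local Notation U := 'I_l.+1.
Implicit Types (pi : policy k l) (w : path_space k) (x y : E) (a : U) (n : nat).

Let b0 : 0 < beta. Proof. by case/andP: hbeta. Qed.
Let b1 : beta < 1. Proof. by case/andP: hbeta. Qed.
Let nb0 : 0 < 1 - beta. Proof. by rewrite subr_gt0. Qed.

Definition reward_bound : R := \sum_x \sum_a `|reward M x a|.

Lemma reward_le x a : `|reward M x a| <= reward_bound.
Proof.
rewrite /reward_bound (bigD1 x) //= (bigD1 a) //= -addrA lerDl addr_ge0 //.
  exact: sumr_ge0.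
by apply: sumr_ge0 => y _; exact: sumr_ge0.
Qed.

Lemma reward_bound_ge0 : 0 <= reward_bound.
Proof. exact: le_trans (reward_le ord0 ord0). Qed.

Definition total_bound : R := reward_bound / (1 - beta).

Lemma total_bound_ge0 : 0 <= total_bound.
Proof. by rewrite divr_ge0 ?reward_bound_ge0 ?ltW. Qed.

Definition partial_reward pi w n : R :=
  \sum_(0 <= i < n) beta ^+ i * reward M (w i) (action_at pi w i).

Lemma partial_rewardS pi w n :
  partial_reward pi w n.+1 =
  partial_reward pi w n + beta ^+ n * reward M (w n) (action_at pi w n).
Proof. by rewrite /partial_reward big_nat_recr. Qed.

Lemma bounded_rv_partial_reward pi n :
  bounded_rv (fun w => partial_reward pi w n).
Proof.
apply: bounded_rv_sum => i; apply: bounded_rvZ.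
apply: eq_bounded_rv (bounded_rv_hist (fun h => reward M (tnth h ord_max) (pi i h))).
by move=> w /=; rewrite tnth_hist.
Qed.

(** This form of the geometric tail bound telescopes, hence the proof by induction. *)
Lemma partial_reward_tail pi w n m :
  `|partial_reward pi w (n + m) - partial_reward pi w n| <=
  total_bound * (beta ^+ n - beta ^+ (n + m)).
Proof.
elim: m => [|m ih]; first by rewrite addn0 !subrr mulr0 normr0.
rewrite addnS partial_rewardS addrAC.
apply: (le_trans (ler_normD _ _)).
have -> : total_bound * (beta ^+ n - beta ^+ (n + m).+1) =
    total_bound * (beta ^+ n - beta ^+ (n + m)) + beta ^+ (n + m) * reward_bound.
  by rewrite /total_bound exprS; field; rewrite gt_eqF.
apply: lerD => //; rewrite normrM ger0_norm ?exprn_ge0 ?(ltW b0) //.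
by rewrite ler_wpM2l ?exprn_ge0 ?(ltW b0) ?reward_le.
Qed.

Lemma cvg_partial_reward pi w :
  partial_reward pi w n @[n --> \oo] --> total_reward M beta pi w.
Proof.
apply: normed_cvg; apply: (@series_le_cvg _ _ (geometric reward_bound beta)) => [n|n|n|].
- exact: normr_ge0.
- by rewrite /geometric /= mulr_ge0 ?reward_bound_ge0 ?exprn_ge0 ?(ltW b0).
- rewrite /geometric /= mulrC normrM [`|beta ^+ n|]ger0_norm ?exprn_ge0 ?(ltW b0) //.
  by rewrite ler_wpM2r ?exprn_ge0 ?(ltW b0) ?reward_le.
- by apply: is_cvg_geometric_series; rewrite ger0_norm ?(ltW b0).
Qed.

Lemma total_reward_tail pi w n :
  `|total_reward M beta pi w - partial_reward pi w n| <= total_bound * beta ^+ n.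
Proof.
have cv : `|partial_reward pi w m - partial_reward pi w n| @[m --> \oo]
    --> `|total_reward M beta pi w - partial_reward pi w n|.
  by apply: cvg_norm; apply: cvgB; [exact: cvg_partial_reward|exact: cvg_cst].
rewrite -(cvg_lim _ cv) //; apply: limr_le; first by apply/cvg_ex; eexists; exact: cv.
near=> m; have nm : (n <= m)%N by near: m; exact: nbhs_infty_ge.
rewrite -(subnKC nm); apply: (le_trans (partial_reward_tail _ _ _ _)).
by rewrite ler_wpM2l ?total_bound_ge0 // gerBl exprn_ge0 ?(ltW b0).
Unshelve. all: by end_near. Qed.

Lemma total_reward_le pi w : `|total_reward M beta pi w| <= total_bound.
Proof.
have := total_reward_tail pi w 0.
by rewrite expr0 mulr1 /partial_reward big_geq // subr0.
Qed.

Lemma measurable_total_reward pi : measurable_fun setT (total_reward M beta pi).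
Proof.
apply: (@measurable_fun_cvg _ _ _ _ (fun n w => partial_reward pi w n)) => [n|w _].
  by have [] := bounded_rv_partial_reward pi n.
exact: cvg_partial_reward.
Qed.

Lemma bounded_rv_total_reward pi : bounded_rv (total_reward M beta pi).
Proof.
split; first exact: measurable_total_reward.
by exists total_bound => w; exact: total_reward_le.
Qed.

End Rewards.

(** * Dynamic programming for the exponential utility *)

Section DynamicProgramming.
Context (R : realType) (k l : nat) (M : mdp R k l) (beta : R).
Context (hbeta : 0 < beta < 1).
Local Notation E := 'I_k.+1.
(* The bare name also refers to Markov's inequality. *)
Local Notation markov := Defs.markov.
Local Notation U := 'I_l.+1.
Implicit Types (pi : policy k l) (x y : E) (a : U) (n : nat) (g : R).
Implicit Types (u : nat -> E -> U) (f v : E -> R).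

Let b0 : 0 < beta. Proof. by case/andP: hbeta. Qed.
Let b1 : beta < 1. Proof. by case/andP: hbeta. Qed.

Definition exp_utility g x pi : R :=
  \int[path_law M x pi]_w expR (g * total_reward M beta pi w).

Definition bellman g f x a : R :=
  expR (g * reward M x a) * \sum_y trans M a x y * f y.

Definition later (n : nat) u : nat -> E -> U := fun i => u (i + n)%N.

Let weight g pi n (w : path_space k) : R := expR (g * partial_reward M beta pi w n).

Let bounded_rv_weight g pi n (v : E -> R) :
  bounded_rv (fun w : path_space k => weight g pi n w * v (w n)).
Proof.
apply: bounded_rvM; last exact: bounded_rv_coordinate.
by apply: bounded_rv_expR; apply: bounded_rvZ; exact: bounded_rv_partial_reward.
Qed.

Lemma bounded_rv_exp_reward g pi :
  bounded_rv (fun w : path_space k => expR (g * total_reward M beta pi w)).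
Proof. by apply: bounded_rv_expR; apply: bounded_rvZ; exact: bounded_rv_total_reward. Qed.

Lemma exp_utility_bounds g x pi :
  expR (- (`|g| * total_bound M beta)) <= exp_utility g x pi <=
  expR (`|g| * total_bound M beta).
Proof.
have K w : `|g * total_reward M beta pi w| <= `|g| * total_bound M beta.
  by rewrite normrM ler_wpM2l ?total_reward_le.
apply/andP; split; rewrite -(Rintegral_prob_cst (path_law M x pi) (expR _));
  apply: Rintegral_le => [||w]; try exact: bounded_rv_cst;
  try exact: bounded_rv_exp_reward; rewrite ler_expR.
- by have := K w; rewrite ler_norml => /andP[].
- by have := K w; rewrite ler_norml => /andP[].
Qed.

Lemma exp_utility_gt0 g x pi : 0 < exp_utility g x pi.
Proof. by have /andP[+ _] := exp_utility_bounds g x pi; apply: lt_le_trans; exact: expR_gt0. Qed.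

(** Both v n and exp(g * (reward from time n on)) are exp(O(beta ^ n)), uniformly in the
    path, so the integrals agree with the utility up to factors exp(+- D beta ^ n). *)
Lemma cvg_exp_utility g x pi (v : nat -> E -> R) (B : R) :
  (forall n y, expR (- (B * beta ^+ n)) <= v n y <= expR (B * beta ^+ n)) ->
  \int[path_law M x pi]_w (weight g pi n w * v n (w n)) @[n --> \oo]
    --> exp_utility g x pi.
Proof.
move=> vB; pose D := `|g| * total_bound M beta + B.
have cvE (s : R) : exp_utility g x pi * expR (s * (D * beta ^+ n)) @[n --> \oo]
    --> exp_utility g x pi.
  have e1 : exp_utility g x pi * expR (s * (D * 0)) = exp_utility g x pi.
    by rewrite !mulr0 expR0 mulr1.
  rewrite -[X in _ --> X]e1; apply: cvgM; first exact: cvg_cst.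
  apply: continuous_cvg; first exact: continuous_expR.
  apply: cvgM; first exact: cvg_cst.
  apply: cvgM; first exact: cvg_cst.
  by rewrite exprn_geometric; apply: cvg_geometric; rewrite ger0_norm ?(ltW b0).
apply: squeeze_cvgr (cvE (-1)) (cvE 1); near=> n.
have bE := bounded_rv_exp_reward g pi.
have ibE : (path_law M x pi).-integrable setT
    (EFin \o (fun w => expR (g * total_reward M beta pi w))).
  exact: bounded_rv_integrable.
have tail w : `|g * total_reward M beta pi w - g * partial_reward M beta pi w n| <=
    `|g| * total_bound M beta * beta ^+ n.
  by rewrite -mulrBr normrM -mulrA ler_wpM2l ?total_reward_tail.
rewrite /exp_utility -!RintegralZr //.
have bEr r : bounded_rv (fun w : path_space k => expR (g * total_reward M beta pi w) * r).
  by apply: bounded_rvM; [exact: bE|exact: bounded_rv_cst].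
have bW : bounded_rv (fun w : path_space k => weight g pi n w * v n (w n)).
  exact: bounded_rv_weight.
apply/andP; split.
- apply: (Rintegral_le _ (bEr _) bW) => w; have /andP[v1 _] := vB n (w n).
  have := tail w; rewrite ler_distl => /andP[_ t2].
  apply: le_trans (ler_wpM2l (expR_ge0 _) v1); rewrite -!expRD ler_expR.
  rewrite mulN1r mulrDl opprD addrA; apply: lerB => //.
  by rewrite lerBlDr.
- apply: (Rintegral_le _ bW (bEr _)) => w; have /andP[_ v2] := vB n (w n).
  have := tail w; rewrite ler_distl => /andP[t1 _].
  apply: (le_trans (ler_wpM2l (expR_ge0 _) v2)); rewrite -!expRD ler_expR.
  rewrite mul1r mulrDl addrA; apply: lerD => //.
  by rewrite -lerBlDr.
Unshelve. all: by end_near. Qed.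

Lemma Rintegral_weightS g x pi n f :
  \int[path_law M x pi]_w (weight g pi n.+1 w * f (w n.+1)) =
  \int[path_law M x pi]_w
    (weight g pi n w * bellman (g * beta ^+ n) f (w n) (action_at pi w n)).
Proof.
(* The weight at time n.+1 depends on the history up to n only; evaluating it on an
   arbitrary extension of that history turns it into a function of the history. *)
pose ext (h : n.+1.-tuple E) : path_space k := fun i => nth ord0 h i.
have extE (w : path_space k) i : (i <= n)%N -> ext (hist w n) i = w i.
  move=> i_n; have i_n1 : (i < n.+1)%N by [].
  by rewrite /ext -[i]/(nat_of_ord (Ordinal i_n1)) -tnth_nth tnth_hist.
have histE (w : path_space k) i : (i <= n)%N -> hist (ext (hist w n)) i = hist w i.
  move=> i_n; apply: eq_from_tnth => j; rewrite !tnth_hist extE //.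
  by rewrite (leq_trans _ i_n) // -ltnS ltn_ord.
have weightE (w : path_space k) : weight g pi n.+1 (ext (hist w n)) = weight g pi n.+1 w.
  rewrite /weight /partial_reward; congr (expR (_ * _)).
  apply: eq_big_nat => i /andP[_]; rewrite ltnS => i_n.
  by rewrite /action_at extE // histE.
transitivity (\int[path_law M x pi]_w (weight g pi n.+1 (ext (hist w n)) * f (w n.+1))).
  by apply: eq_Rintegral => w _; rewrite weightE.
apply: (etrans (Rintegral_hist_next M x pi (fun h y => weight g pi n.+1 (ext h) * f y))).
apply: eq_Rintegral => w _.
rewrite weightE /bellman mulrA.
have -> : weight g pi n w * expR (g * beta ^+ n * reward M (w n) (action_at pi w n)) =
    weight g pi n.+1 w.
  by rewrite /weight partial_rewardS -expRD mulrDr mulrA.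
by rewrite mulr_sumr; apply: eq_bigr => y _; rewrite mulrCA.
Qed.

Lemma Rintegral_weight0 g x pi f :
  \int[path_law M x pi]_w (weight g pi 0 w * f (w 0%N)) = f x.
Proof.
rewrite -[RHS](Rintegral_start M x pi f); apply: eq_Rintegral => w _.
by rewrite /weight /partial_reward big_geq // mulr0 expR0 mul1r.
Qed.

(** Under the inequalities, s * exp(g S_n) v_n(X_n) is a supermartingale (S_n being the
    reward collected before time n); it starts at s * v_0(x) and its expectation tends
    to s times the utility.  Both signs of s are used: s > 0 bounds the utility from
    above, s < 0 from below. *)
Lemma verification (s g B : R) x pi (v : nat -> E -> R) :
  (forall n y, expR (- (B * beta ^+ n)) <= v n y <= expR (B * beta ^+ n)) ->
  (forall n (w : path_space k),
     s * bellman (g * beta ^+ n) (v n.+1) (w n) (action_at pi w n) <= s * v n (w n)) ->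
  s * exp_utility g x pi <= s * v 0%N x.
Proof.
move=> vB vle.
have cv : s * \int[path_law M x pi]_w (weight g pi n w * v n (w n)) @[n --> \oo]
    --> s * exp_utility g x pi.
  by apply: cvgM; [exact: cvg_cst|exact: cvg_exp_utility vB].
rewrite -(cvg_lim _ cv) //; apply: limr_le; first by apply/cvg_ex; eexists; exact: cv.
near=> n; elim: (n) => [|i]; first by rewrite Rintegral_weight0.
apply: le_trans; rewrite Rintegral_weightS.
have bW := bounded_rv_weight g pi i.
have bB : bounded_rv (fun w : path_space k =>
    weight g pi i w * bellman (g * beta ^+ i) (v i.+1) (w i) (action_at pi w i)).
  apply: bounded_rvM.
    by apply: bounded_rv_expR; apply: bounded_rvZ; exact: bounded_rv_partial_reward.
  apply: eq_bounded_rv (bounded_rv_hist (fun h : i.+1.-tuple E =>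
    bellman (g * beta ^+ i) (v i.+1) (tnth h ord_max) (pi i h))).
  by move=> w /=; rewrite tnth_hist.
rewrite -!RintegralZl //; [|exact: bounded_rv_integrable..].
apply: Rintegral_le => [||w]; [exact: bounded_rvZ..|].
by rewrite mulrCA [leRHS]mulrCA ler_wpM2l ?expR_ge0.
Unshelve. all: by end_near. Qed.

(** Computed backwards in time, unlike the law of the process; comparing it with the
    integral of the forward weights gives the recursion for the utility. *)
Fixpoint horizon_utility (n : nat) g u x : R :=
  if n is m.+1 then bellman g (horizon_utility m (g * beta) (later 1 u)) x (u 0%N x)
  else 1.

Lemma action_markov u (w : path_space k) n : action_at (markov u) w n = u n (w n).
Proof. by rewrite /action_at /markov tnth_hist. Qed.

Lemma later_add n m u : later m (later n u) = later (m + n) u.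
Proof. by apply/funext => i; rewrite /later addnA. Qed.

Lemma Rintegral_weight_horizon g x u n m :
  \int[path_law M x (markov u)]_w (weight g (markov u) (n + m) w * 1) =
  \int[path_law M x (markov u)]_w
    (weight g (markov u) n w * horizon_utility m (g * beta ^+ n) (later n u) (w n)).
Proof.
elim: m n => [|m ih] n; first by rewrite addn0.
rewrite addnS -addSn ih Rintegral_weightS; apply: eq_Rintegral => w _ /=.
by rewrite action_markov later_add add1n exprSr mulrA.
Qed.

Lemma cvg_horizon_utility g x u :
  horizon_utility n g u x @[n --> \oo] --> exp_utility g x (markov u).
Proof.
have -> : (fun n => horizon_utility n g u x) =
    (fun n => \int[path_law M x (markov u)]_w (weight g (markov u) n w * 1)).
  apply/funext => n; have /= := Rintegral_weight_horizon g x u 0 n.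
  rewrite add0n expr0 mulr1 => ->; rewrite (Rintegral_weight0 _ _ _ (horizon_utility _ _ _)).
  by congr horizon_utility; apply/funext => i; rewrite /later addn0.
apply: (@cvg_exp_utility g x (markov u) (fun _ _ => 1) 0) => n y.
by rewrite mul0r oppr0 expR0 lexx.
Qed.

(** The recursion holds by definition at every finite horizon and passes to the
    limit. *)
Lemma exp_utility_markov g x u :
  exp_utility g x (markov u) =
  bellman g (fun y => exp_utility (g * beta) y (markov (later 1 u))) x (u 0%N x).
Proof.
have c1 := @cvg_horizon_utility g x u.
rewrite -(cvg_shiftS (fun n => horizon_utility n g u x)) /= in c1.
have c2 : bellman g (horizon_utility n (g * beta) (later 1 u)) x (u 0%N x) @[n --> \oo] -->
    bellman g (fun y => exp_utility (g * beta) y (markov (later 1 u))) x (u 0%N x).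
  apply: cvgM; first exact: cvg_cst.
  apply: cvg_big => [|y _]; first exact: add_continuous.
  apply: cvgM; first exact: cvg_cst.
  exact: cvg_horizon_utility.
exact: (cvg_unique _ c1 c2).
Qed.

End DynamicProgramming.

(** * Optimal policies and the turnpike *)

Section Turnpike.
Context (R : realType) (k l : nat) (M : mdp R k l) (beta : R).
Context (hbeta : 0 < beta < 1).
Local Notation E := 'I_k.+1.
(* The bare name also refers to Markov's inequality. *)
Local Notation markov := Defs.markov.
Local Notation U := 'I_l.+1.
Implicit Types (pi : policy k l) (x y : E) (a : U) (n N : nat) (g s t : R).
Implicit Types (u : nat -> E -> U).
Local Notation W := (exp_utility M beta).
Local Notation Q := (bellman M).

Let b0 : 0 < beta. Proof. by case/andP: hbeta. Qed.
Let b1 : beta < 1. Proof. by case/andP: hbeta. Qed.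

(** Finite codes of the Markov policies that repeat one rule from time N on. *)
Definition rule_code N := {ffun 'I_N.+1 -> {ffun E -> U}}.

Definition decode N (c : rule_code N) : nat -> E -> U :=
  fun n => c (inord (minn n N)).

Lemma decode_tail N (u : nat -> E -> U) (v : E -> U) :
  (forall n, (N <= n)%N -> u n = v) -> exists c : rule_code N, decode c = u.
Proof.
move=> uv; exists [ffun i : 'I_N.+1 => [ffun x => u i x]].
apply/funext => n; apply/funext => x; rewrite /decode !ffunE inordK ?ltnS ?geq_minr //.
by have [nN|Nn] := leqP n N; rewrite // !uv // ltnW.
Qed.

Lemma utility_order_constant N t s : `|s| = 1 ->
  exists2 e : R, 0 < e & forall (r : R) (c c' : rule_code N) x h h',
    0 < h < e -> 0 < h' < e ->
    r * W (t + s * h) x (markov (decode c)) <= r * W (t + s * h) x (markov (decode c')) ->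
    r * W (t + s * h') x (markov (decode c)) <= r * W (t + s * h') x (markov (decode c')).
Proof.
move=> s1; pose I := (rule_code N * rule_code N * E)%type.
pose D (i : I) h := W (t + s * h) i.2 (markov (decode i.1.2)) -
                    W (t + s * h) i.2 (markov (decode i.1.1)).
have /choice[e eP] : forall i : I, exists e : R, 0 < e /\
    exists r, forall h, 0 < h < e -> Num.sg (D i h) = r.
  move=> [[c c'] x] /=.
  have [e e0 er] := sgr_laplace_difference
    (path_law M x (markov (decode c'))) (path_law M x (markov (decode c))) t
    (measurable_total_reward M hbeta (markov (decode c')))
    (total_reward_le M hbeta (markov (decode c')))
    (measurable_total_reward M hbeta (markov (decode c)))
    (total_reward_le M hbeta (markov (decode c))) s1.
  by exists e.
have [d d0 de] := lower_bound_gt0 (fun i => (eP i).1).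
exists d => // r c c' x h h' /andP[h0 hd] /andP[h'0 h'd].
have [_ [q qP]] := eP (c, c', x); have ed := de (c, c', x).
have {qP} : Num.sg (D (c, c', x) h) = Num.sg (D (c, c', x) h').
  by rewrite !qP ?h0 ?h'0 /= ?(lt_le_trans hd) ?(lt_le_trans h'd).
rewrite /D /= => qE; rewrite -subr_ge0 -mulrBr -sgr_ge0 sgrM qE -sgrM sgr_ge0.
by rewrite mulrBr subr_ge0.
Qed.

Lemma exp_utility_decay g pi n y :
  expR (- (`|g| * total_bound M beta * beta ^+ n)) <= W (g * beta ^+ n) y pi <=
  expR (`|g| * total_bound M beta * beta ^+ n).
Proof.
have := exp_utility_bounds M hbeta (g * beta ^+ n) y pi.
by rewrite normrM [`|beta ^+ n|]ger0_norm ?exprn_ge0 ?(ltW b0) // mulrAC.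
Qed.

Lemma bellman_le s g (f f' : E -> R) x a :
  (forall y, s * f y <= s * f' y) -> s * Q g f x a <= s * Q g f' x a.
Proof.
move=> ff'; rewrite /bellman mulrCA [leRHS]mulrCA ler_wpM2l ?expR_ge0 //.
rewrite !mulr_sumr; apply: ler_sum => y _; rewrite mulrCA [leRHS]mulrCA.
by rewrite ler_wpM2l ?trans_ge0.
Qed.

(** Choose v maximising the sum over x of s * W at one small factor.  If deviating from
    v to a, once and at time 0 only, were profitable from x0 at some small factor, it
    would be so at all of them, because the sign of the gain is constant.  Deviating
    to a at every visit of x0 would then be a strict improvement of v at the chosen
    factor.  All small factors are needed here, as the factor shrinks by beta with
    time. *)
Lemma optimal_stationary_small s : `|s| = 1 ->
  exists2 e : R, 0 < e & exists v : E -> U, forall h x a, 0 < h < e ->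
    s * Q (s * h) (fun y => W (s * h * beta) y (markov (fun=> v))) x a <=
    s * W (s * h) x (markov (fun=> v)).
Proof.
move=> s1; have [e e0 cst] := utility_order_constant 1 0 s1.
exists e => //; pose h1 := e / 2.
have h1e : 0 < h1 < e by rewrite divr_gt0 //= ltr_pdivrMr // ltr_pMr // ltr1n.
pose S (v : {ffun E -> U}) := \sum_x s * W (s * h1) x (markov (fun=> v : E -> U)).
have [v vmax] : exists v, forall v', S v' <= S v.
  exists [arg max_(v > [ffun=> ord0] : {ffun E -> U}) S v]%O.
  by case: Order.TotalTheory.arg_maxP => // v _ vmax v'; exact: vmax.
exists v => h x0 a he; rewrite leNgt; apply/negP => lt_dev.
pose dev n : E -> U := if n is 0 then fun=> a else v.
have devE g x : W g x (markov dev) = Q g (fun y => W (g * beta) y (markov (fun=> v : E -> U))) x a.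
  have later_dev : later 1 dev = (fun=> v : E -> U).
    by apply/funext => i; rewrite /later addn1.
  by rewrite exp_utility_markov // later_dev.
have statE (z : E -> U) g x : W g x (markov (fun=> z)) =
    Q g (fun y => W (g * beta) y (markov (fun=> z))) x (z x).
  by rewrite exp_utility_markov.
have [cd cdE] : exists c : rule_code 1, decode c = dev.
  by apply: (@decode_tail _ _ v) => -[].
have [cv cvE] : exists c : rule_code 1, decode c = (fun=> v : E -> U).
  exact: (@decode_tail _ _ v).
(* The one-time deviation is profitable at all small factors. *)
have better h' : 0 < h' < e -> s * W (s * h') x0 (markov (fun=> v : E -> U)) <
    s * W (s * h') x0 (markov dev).
  move=> h'e; rewrite ltNge; apply/negP => le_dev.
  move: lt_dev; rewrite -devE ltNge => /negP; apply.
  have := cst s cd cv x0 h' h h'e he; rewrite !add0r cdE cvE; exact.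
pose v' : {ffun E -> U} := [ffun x => if x == x0 then a else v x].
(* Verification with -s: the values of v bound those of v' from below. *)
have improve h' x : 0 < h' < e -> s * W (s * h') x (markov (fun=> v : E -> U)) <=
    s * W (s * h') x (markov (fun=> v' : E -> U)).
  move=> /andP[h'0 h'e].
  have := @verification R k l M beta hbeta (- s) (s * h') (`|s * h'| * total_bound M beta) x
    (markov (fun=> v' : E -> U))
    (fun n y => W (s * h' * beta ^+ n) y (markov (fun=> v : E -> U))).
  rewrite expr0 mulr1 !mulNr lerN2; apply=> [n y|n w].
    exact: exp_utility_decay.
  rewrite !mulNr lerN2 action_markov ffunE exprSr [s * h' * (_ * _)]mulrA.
  case: eqP => [->|_]; last by rewrite [W _ (w n) _]statE.
  rewrite -devE -mulrA; apply/ltW/better.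
  rewrite mulr_gt0 ?exprn_gt0 //= (le_lt_trans _ h'e) // ler_piMr ?(ltW h'0) //.
  by rewrite exprn_ile1 ?(ltW b0) ?(ltW b1).
suff : S v < S v' by rewrite ltNge vmax.
(* From x0, v' begins with the profitable deviation and then does at least as well
   as v. *)
rewrite /S (bigD1 x0) //= [ltRHS](bigD1 x0) //=; apply: ltr_leD; last first.
  by apply: ler_sum => x _; exact: improve.
apply: (lt_le_trans (better _ h1e)); rewrite devE [leRHS](congr1 _ (statE v' _ _)).
rewrite ffunE eqxx; apply: bellman_le => y; rewrite -mulrA; apply: improve.
by case/andP: h1e => h10 h1e; rewrite mulr_gt0 //= (lt_trans _ h1e) // gtr_pMr.
Qed.

(** Backward induction on N: the rule at time 0 maximises the Bellman operator applied
    to the utility, at factor s * h * beta, of the policy found for h * beta. *)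
Lemma optimal_extension s e (v : E -> U) : 0 < e ->
  (forall h x a, 0 < h < e ->
    s * Q (s * h) (fun y => W (s * h * beta) y (markov (fun=> v))) x a <=
    s * W (s * h) x (markov (fun=> v))) ->
  forall N h, 0 < h -> h * beta ^+ N < e ->
  exists u, (forall n, (N <= n)%N -> u n = v) /\
    forall n x a,
      s * Q (s * h * beta ^+ n)
            (fun y => W (s * h * beta ^+ n.+1) y (markov (later n.+1 u))) x a <=
      s * W (s * h * beta ^+ n) x (markov (later n u)).
Proof.
move=> e0 vopt; elim=> [|N ih] h h0 he.
  exists (fun=> v); split=> // n x a; rewrite /later exprSr mulrA -mulrA.
  apply: vopt; rewrite mulr_gt0 ?exprn_gt0 //=.
  rewrite expr0 mulr1 in he; rewrite (le_lt_trans _ he) // ler_piMr ?(ltW h0) //.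
  by rewrite exprn_ile1 ?(ltW b0) ?(ltW b1).
have [||u [uv uopt]] := ih (h * beta); first by rewrite mulr_gt0.
  by rewrite -mulrA -exprS.
pose f y := W (s * h * beta) y (markov u).
have /choice[u0 u0max] : forall x, exists a, forall a', s * Q (s * h) f x a' <= s * Q (s * h) f x a.
  move=> x; exists [arg max_(a > ord0) s * Q (s * h) f x a]%O.
  by case: Order.TotalTheory.arg_maxP => // a _ amax a'; exact: amax.
pose u' n := if n is m.+1 then u m else u0.
have laterE n : later n.+1 u' = later n u by apply/funext => i; rewrite /later addnS.
have later0 z : later 0 z = z :> (nat -> E -> U) by apply/funext => i; rewrite /later addn0.
exists u'; split=> [[//|n]|[|n] x a]; first exact: uv.
  rewrite expr0 expr1 mulr1 laterE !later0 exp_utility_markov // laterE later0.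
  exact: u0max.
have := uopt n x a; rewrite !laterE [s * (h * beta)]mulrA.
by rewrite -[s * h * beta * _]mulrA -exprS -[s * h * beta * _]mulrA -exprS.
Qed.

Lemma optimal_extension_max s h u :
  (forall n x a,
     s * Q (s * h * beta ^+ n)
           (fun y => W (s * h * beta ^+ n.+1) y (markov (later n.+1 u))) x a <=
     s * W (s * h * beta ^+ n) x (markov (later n u))) ->
  forall x pi, s * W (s * h) x pi <= s * W (s * h) x (markov u).
Proof.
move=> uopt x pi.
have := @verification R k l M beta hbeta s (s * h) (`|s * h| * total_bound M beta) x pi
  (fun n y => W (s * h * beta ^+ n) y (markov (later n u))).
have -> : later 0 u = u by apply/funext => i; rewrite /later addn0.
rewrite expr0 mulr1; apply=> [n y|n w]; first exact: exp_utility_decay.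
exact: uopt.
Qed.

Lemma J_le s g x pi pi' : 0 < s * g ->
  (J M beta g x pi <= J M beta g x pi') = (s * W g x pi <= s * W g x pi').
Proof.
move=> sg; have g0 : g != 0 by apply: contraTneq sg => ->; rewrite mulr0 ltxx.
have JE p : J M beta g x p = g^-1 * ln (W g x p).
  by rewrite /J (negbTE g0) /exp_utility /Rintegral unlock.
rewrite !JE; have Wpos p : W g x p \is Num.pos by exact: exp_utility_gt0.
case: (ltrgt0P g) g0 => // gs _; move: sg.
- rewrite pmulr_lgt0 // => s0.
  by rewrite ler_pM2l ?invr_gt0 // ler_ln // ler_pM2l.
- rewrite nmulr_lgt0 // => s0.
  by rewrite ler_nM2l ?invr_lt0 // ler_ln // ler_nM2l.
Qed.

(** A dominating policy u makes the supremum in the definition of optimality a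
    maximum, so that optimality becomes a comparison with u. *)
Lemma optimal_markovE s g u u' : 0 < s * g ->
  (forall x pi, s * W g x pi <= s * W g x (markov u)) ->
  optimal_markov M beta g u' <->
  forall x, s * W g x (markov u) <= s * W g x (markov u').
Proof.
move=> sg umax.
have supE x : sup [set J M beta g x pi | pi in [set: policy k l]] = J M beta g x (markov u).
  have ub : ubound [set J M beta g x pi | pi in [set: policy k l]] (J M beta g x (markov u)).
    by move=> _ [pi _ <-]; rewrite (J_le _ _ _ sg).
  apply/le_anti/andP; split.
    by apply: ge_sup => //; exists (J M beta g x (markov u)), (markov u).
  by apply: ub_le_sup; [exists (J M beta g x (markov u))|exists (markov u)].
split=> opt x.
  by rewrite -(J_le _ _ _ sg) opt supE.
apply/le_anti; rewrite supE !(J_le _ _ _ sg) umax; exact: opt.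
Qed.

(** At t = 0 the sign depends on the side; elsewhere it is that of t. *)
Lemma factor_sign_aside t s : `|s| = 1 ->
  exists r : R, `|r| = 1 /\ exists2 e : R, 0 < e &
    forall h, 0 < h < e -> 0 < r * (t + s * h).
Proof.
move=> s1; have [->|t0] := eqVneq t 0.
  exists s; split=> //; exists 1 => // h /andP[h0 _].
  by rewrite add0r mulrA -expr2 -real_normK ?num_real // s1 expr1n mul1r.
exists (Num.sg t); split; first by rewrite normr_sg t0.
exists `|t|; first by rewrite normr_gt0.
move=> h /andP[h0 ht]; rewrite mulrDr -normrEsg -[X in X + _]opprK addrC subr_gt0.
have : `|Num.sg t * (s * h)| < `|t| by rewrite !normrM normr_sg t0 s1 !mul1r gtr0_norm.
by rewrite ltr_norml => /andP[].
Qed.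

(** A dominating policy shows every n > N to be a threshold at all these factors.  For
    n <= N, a witness is one of finitely many policies, and its optimality is a
    comparison within them. *)
Lemma turnpike_locally_constant t s : `|s| = 1 ->
  locally_constant_aside (turnpike M beta) s t.
Proof.
move=> s1.
have [r [r1 [e1 e10 rpos]]] := factor_sign_aside t s1.
have [e2 e20 [v vopt]] := optimal_stationary_small r1.
have rr : r * r = 1 by rewrite -expr2 -real_normK ?num_real // r1 expr1n.
have [N [N0 Ne]] : exists N, (0 < N)%N /\ (`|t| + 1) * beta ^+ N < e2.
  have cv : geometric (`|t| + 1) beta n @[n --> \oo] --> (0 : R).
    by apply: cvg_geometric; rewrite ger0_norm ?(ltW b0).
  have [N _ NP] := @cvgr_lt _ _ _ _ _ _ cv e2 e20.
  by exists N.+1; split=> //; exact: NP (leqnSn N).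
have [e3 e30 cst] := utility_order_constant N t s1.
exists (Num.min e1 (Num.min 1 e3)); first by rewrite !lt_min e10 ltr01.
(* In this one-sided neighbourhood some policy with N initial rules dominates
   every policy. *)
have dom h : 0 < h < Num.min e1 (Num.min 1 e3) ->
    exists c : rule_code N, forall x pi,
      r * W (t + s * h) x pi <= r * W (t + s * h) x (markov (decode c)).
  rewrite !lt_min => /and4P[h0 he1 h1 he3].
  have g0 : 0 < r * (t + s * h) by apply: rpos; rewrite h0.
  have gE : t + s * h = r * (r * (t + s * h)) by rewrite mulrA rr mul1r.
  have le_g : r * (t + s * h) <= `|t| + 1.
    rewrite (le_trans (ler_norm _)) // normrM r1 mul1r (le_trans (ler_normD _ _)) //.
    by rewrite lerD2l normrM s1 mul1r gtr0_norm // ltW.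
  have [|u [uv uopt]] := optimal_extension e20 vopt g0 (N := N).
    by rewrite (le_lt_trans _ Ne) // ler_wpM2r ?exprn_ge0 ?(ltW b0).
  have [c cu] := decode_tail uv; exists c => x pi; rewrite cu gE.
  exact: optimal_extension_max.
have tail (c : rule_code N) n : (N <= n)%N -> decode c n = c (inord N) :> (E -> U).
  by move=> Nn; rewrite /decode (minn_idPr Nn).
have threshold h h' n : 0 < h < Num.min e1 (Num.min 1 e3) ->
    0 < h' < Num.min e1 (Num.min 1 e3) ->
    stationarity_threshold M beta (t + s * h) n ->
    stationarity_threshold M beta (t + s * h') n.
  move=> he h'e; have [c0 c0max] := dom _ he; have [c1 c1max] := dom _ h'e.
  move: he h'e; rewrite !lt_min => /and4P[h0 he1 _ he3] /and4P[h'0 h'e1 _ h'e3].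
  have g0 : 0 < r * (t + s * h) by apply: rpos; rewrite h0.
  have g'0 : 0 < r * (t + s * h') by apply: rpos; rewrite h'0.
  move=> [n0 [u [w [uw uopt]]]]; split=> //; have [nN|Nn] := leqP n N; last first.
    exists (decode c1), (c1 (inord N)); split.
      by move=> i ni; apply: tail; rewrite (leq_trans (ltnW Nn)).
    by apply/(optimal_markovE _ g'0 c1max).
  exists u, w; split=> //.
  have [c cu] : exists c : rule_code N, decode c = u.
    by apply: (@decode_tail _ _ w) => i Ni; apply: uw; exact: leq_trans Ni.
  move/(optimal_markovE _ g0 c0max) in uopt.
  apply/(optimal_markovE _ g'0 c1max) => x; rewrite -cu.
  apply: (cst r c1 c x h h'); rewrite ?h0 ?h'0 //.
  by rewrite cu (le_trans (c0max x _)).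
move=> h h' he h'e; rewrite /turnpike.
suff -> : stationarity_threshold M beta (t + s * h) =
          stationarity_threshold M beta (t + s * h') by [].
by apply/funext => n; apply/propext; split; exact: threshold.
Qed.

End Turnpike.

Theorem corollary4p7 (R : realType) (k l : nat) (M : mdp R k l) (beta : R)
    (hbeta : 0 < beta < 1) (a b : R) (hab : a <= b) :
  exists (n : nat) (I : nat -> interval R),
    partition `I_n (fun i => [set` I i]) [set` `[a, b]] /\
    (forall i, (i < n)%N -> forall gamma gamma' : R,
       gamma \in I i -> gamma' \in I i ->
       turnpike M beta gamma = turnpike M beta gamma').
Proof.
apply: piecewise_constant_on_itv => // t.
- by apply: turnpike_locally_constant => //; rewrite normr1.
- by apply: turnpike_locally_constant => //; rewrite normrN1.
Qed.
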